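(* Let $(\mathcal{K},[\cdot,\cdot])$ be a Krein space with fundamental symmetry $J$ and let $\{\eta_x^1,\ldots,\eta_x^n\}_{x\in\mathcal{M}}$ be a continuous frame of rank $n\in\mathbb{N}$ for $\mathcal{K}$ with respect to the signed measure space $(\mathcal{M},\mathfrak{B},\nu)$, with frame operator $\mathbf{S}$. Then, in the sense of weak integrals, $$\mathbf{1}_{\mathcal{K}}=\sum_{i=1}^n\int_{\mathcal{M}}|\eta_x^i]\,[\mathbf{S}^{-1}\eta_x^i|\,d|\nu|(x)=\sum_{i=1}^n\int_{\mathcal{M}}|\mathbf{S}^{-1}\eta_x^i]\,[\eta_x^i|\,d|\nu|(x).$$
   Context: Krein spaces are complex; the inner product $[\cdot,\cdot]$ is Hermitian, conjugate-linear in the first and linear in the second variable. A Krein space $(\mathcal{K},[\cdot,\cdot])$ comes with a fundamental decomposition $\mathcal{K}=\mathcal{K}_+[\dotplus]\mathcal{K}_-$ (a direct sum, orthogonal with respect to $[\cdot,\cdot]$, such that $(\mathcal{K}_+,[\cdot,\cdot])$ and $(\mathcal{K}_-,-[\cdot,\cdot])$ are Hilbert spaces) and fundamental symmetry $J(k^++k^-)=k^+-k^-$. The $J$-inner product $[h,k]_J:=[h,Jk]$ makes $\mathcal{K}$ a Hilbert space with $J$-norm $\|k\|_J=\sqrt{[k,k]_J}$; $\mathcal{B}(\mathcal{K})$ denotes the operators bounded in this norm. $\nu$ is a signed measure on $(\mathcal{M},\mathfrak{B})$ with total variation measure $|\nu|$. A map $\eta:\mathcal{M}\to\mathcal{K}$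 is weakly measurable if $x\mapsto[\eta(x),k]$ is measurable for every $k\in\mathcal{K}$. A family $\{\eta_x^1,\ldots,\eta_x^n\}_{x\in\mathcal{M}}$ in $\mathcal{K}$, with $\eta_x^1,\ldots,\eta_x^n$ linearly independent for each $x$, is a continuous frame of rank $n$ for $\mathcal{K}$ with respect to $(\mathcal{M},\mathfrak{B},\nu)$ if each $x\mapsto\eta_x^i$ is weakly measurable and there are constants $0<a\le b$ with $a\|k\|_J^2\le\sum_{i=1}^n\int_{\mathcal{M}}|[\eta_x^i,k]|^2\,d|\nu|(x)\le b\|k\|_J^2$ for all $k\in\mathcal{K}$. For $\eta,\zeta\in\mathcal{K}$, $|\eta][\zeta|$ denotes the operator $k\mapsto[\zeta,k]\,\eta$. The weak integral of a function $F:\mathcal{M}\to\mathcal{B}(\mathcal{K})$ with respect to $|\nu|$ is the operator $A\in\mathcal{B}(\mathcal{K})$ (if it exists) such that $\int_{\mathcal{M}}[h,F(x)k]\,d|\nu|(x)=[h,Ak]$ for all $h,k\in\mathcal{K}$. The frame operator is the operator $\mathbf{S}=\sum_{i=1}^n\int_{\mathcal{M}}|\eta_x^i][\eta_x^i|\,d|\nu|(x)\in\mathcal{B}(\mathcal{K})$, i.e. $[h,\mathbf{S}k]=\sum_{i=1}^n\int_{\mathcal{M}}[h,\eta_x^i][\eta_x^i,k]\,d|\nu|(x)$ for all $h,k\in\mathcal{K}$; it has a bounded inverse $\mathbf{S}^{-1}$. *)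

(* Defs.v *)
From HB Require Import structures.
From mathcomp Require Import all_boot all_order all_algebra.
From mathcomp Require Import all_classical all_reals all_analysis.
From mathcomp Require Import complex.

Set Implicit Arguments.
Unset Strict Implicit.
Unset Printing Implicit Defensive.

Import Order.TTheory GRing.Theory Num.Theory.
Import numFieldNormedType.Exports.

Local Open Scope classical_set_scope.
Local Open Scope ring_scope.

(* Values in [-oo, +oo] are allowed (the charges of MathComp-Analysis are
   finite), but not both infinite values. *)
Record signed_measure (d : measure_display) (T : measurableType d)
    (R : realType) (nu : set T -> \bar R) : Prop := SignedMeasure {
  signed_measure0 : nu set0 = 0%E ;
  signed_measure_one_infinity :
    (forall A, measurable A -> nu A != -oo%E) \/
    (forall A, measurable A -> nu A != +oo%E) ;
  signed_measure_sigma_additive : semi_sigma_additive nu }.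

(* |nu| as the sum of the upper and the lower variation of nu; both are
   nonnegative because set0 is among the measurable subsets. *)
Definition total_variation_measure (d : measure_display) (T : measurableType d)
    (R : realType) (nu : set T -> \bar R) (A : set T) : \bar R :=
  (ereal_sup [set nu B | B in [set B | measurable B /\ B `<=` A]] +
   ereal_sup [set - nu B | B in [set B | measurable B /\ B `<=` A]])%E.

Section ComplexIntegral.
Context (d : measure_display) (T : measurableType d) (R : realType).
Implicit Types (mu : set T -> \bar R) (f : T -> R[i]).

Definition cmeasurable f : Prop :=
  measurable_fun setT (fun x => complex.Re (f x)) /\
  measurable_fun setT (fun x => complex.Im (f x)).

Definition cintegrable mu f : Prop :=
  mu.-integrable setT (fun x => (complex.Re (f x))%:E) /\
  mu.-integrable setT (fun x => (complex.Im (f x))%:E).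

Definition cintegral mu f : R[i] :=
  Complex (fine (\int[mu]_x (complex.Re (f x))%:E))
          (fine (\int[mu]_x (complex.Im (f x))%:E)).

End ComplexIntegral.

Section KreinSpace.
Context (R : realType) (K : lmodType R[i]).
Implicit Types (ip : K -> K -> R[i]) (V : set K) (J : K -> K).

(* conjugate-linear in the first variable, linear in the second *)
Definition hermitian_form ip : Prop :=
  (forall h a k l, ip h (a *: k + l) = a * ip h k + ip h l) /\
  (forall h k, ip k h = (ip h k)^*).

Definition linear_subspace V : Prop :=
  V 0 /\ forall a u v, V u -> V v -> V (a *: u + v).

(* Intended for forms such that ip k k is real and nonnegative. *)
Definition form_norm ip (k : K) : R := Num.sqrt (complex.Re (ip k k)).

Definition complete_subspace ip V : Prop :=
  forall u : nat -> K, (forall m, V (u m)) ->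
    (forall e : R, 0 < e -> exists N : nat, forall m p : nat,
       (N <= m)%N -> (N <= p)%N -> form_norm ip (u m - u p) < e) ->
    exists2 l, V l & (fun m => form_norm ip (u m - l)) @ \oo --> (0 : R).

(* The order on R[i] makes 0 < ip v v mean "real and positive". *)
Definition hilbert_subspace ip V : Prop :=
  [/\ linear_subspace V,
      forall v, V v -> v != 0 -> 0 < ip v v
    & complete_subspace ip V].

Definition fundamental_decomposition ip (Kp Km : set K) : Prop :=
  [/\ hilbert_subspace ip Kp,
      hilbert_subspace (fun h k => - ip h k) Km,
      forall kp km, Kp kp -> Km km -> ip kp km = 0,
      Kp `&` Km = [set 0]
    & forall k, exists kp km, [/\ Kp kp, Km km & k = kp + km]].

(* (K, ip) is a Krein space and J is one of its fundamental symmetries. *)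
Definition krein_space ip J : Prop :=
  hermitian_form ip /\
  exists Kp Km, fundamental_decomposition ip Kp Km /\
    forall kp km, Kp kp -> Km km -> J (kp + km) = kp - km.

Definition J_norm ip J : K -> R := form_norm (fun h k => ip h (J k)).

Definition bounded_operator ip J (A : {linear K -> K}) : Prop :=
  exists M : R, forall k, J_norm ip J (A k) <= M * J_norm ip J k.

(* |eta][zeta| *)
Definition rank_one ip (eta zeta k : K) : K := ip zeta k *: eta.

End KreinSpace.

Section Frames.
Context (d : measure_display) (T : measurableType d) (R : realType).
Context (nu : set T -> \bar R) (K : lmodType R[i]).
Context (ip : K -> K -> R[i]) (J : K -> K).

Definition weakly_measurable (f : T -> K) : Prop :=
  forall k, cmeasurable (fun x => ip (f x) k).

(* A is the weak integral of F with respect to |nu|. *)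
Definition weak_integral (F : T -> K -> K) (A : {linear K -> K}) : Prop :=
  bounded_operator ip J A /\
  forall h k,
    cintegrable (total_variation_measure nu) (fun x => ip h (F x k)) /\
    cintegral (total_variation_measure nu) (fun x => ip h (F x k)) = ip h (A k).

(* B is the sum of the weak integrals of F_1, ..., F_n. *)
Definition sum_weak_integrals (n : nat) (F : 'I_n -> T -> K -> K)
    (B : K -> K) : Prop :=
  exists A : 'I_n -> {linear K -> K},
    (forall i, weak_integral (F i) (A i)) /\
    forall k, B k = \sum_(i < n) A i k.

Context (n : nat) (eta : 'I_n -> T -> K).

Definition continuous_frame : Prop :=
  [/\ forall x (c : 'I_n -> R[i]),
        \sum_(i < n) c i *: eta i x = 0 -> forall i, c i = 0,
      forall i, weakly_measurable (eta i)
    & exists a b : R, [/\ 0 < a, a <= b & forall k : K,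
        ((a * J_norm ip J k ^+ 2)%:E <=
          \sum_(i < n) \int[total_variation_measure nu]_x
             (complex.Re `|ip (eta i x) k| ^+ 2)%:E <=
         (b * J_norm ip J k ^+ 2)%:E)%E]].

Definition frame_operator (S : {linear K -> K}) : Prop :=
  bounded_operator ip J S /\
  forall h k, ip h (S k) =
    \sum_(i < n) cintegral (total_variation_measure nu)
                   (fun x => ip h (eta i x) * ip (eta i x) k).

End Frames.

(* Main.v *)
Require Import Defs.
From HB Require Import structures.
From mathcomp Require Import all_boot all_order all_algebra.
From mathcomp Require Import all_classical all_reals all_analysis.
From mathcomp Require Import measurable_realfun complex.
From mathcomp Require Import ring lra.

(** The candidate operators are easy to guess.  With
    [Q_i h k = \int ip h (eta_i x) * ip (eta_i x) k], suppose that the weak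
    integral [A_i] of [|eta_i][eta_i|] exists, i.e. [ip h (A_i k) = Q_i h k].
    The sum of the [A_i] is [S], since the inner product is nondegenerate, and
    [S], hence [S^-1], is symmetric for [ip], since each [Q_i] is hermitian.
    Therefore
    - [|eta_i][S^-1 eta_i| k = |eta_i][eta_i| (S^-1 k)], whose weak integral is
      [A_i S^-1];
    - [|S^-1 eta_i][eta_i| k = S^-1 (|eta_i][eta_i| k)], whose weak integral is
      [S^-1 A_i], because [S^-1] moves to the other side of [ip];
    and the two sums are [S S^-1 = 1] and [S^-1 S = 1].

    The substance is the existence of the individual [A_i]; the frame operator
    only provides their sum.  By the upper frame bound, [Q_i] is a positive
    hermitian form dominated by the squared [J]-norm, so by Cauchy-Schwarz each
    [Q_i k] is a bounded functional, which the Riesz theorem represents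
    ([bounded_form_operator]).  The Riesz theorem is applied separately in the
    two Hilbert spaces of a fundamental decomposition ([krein_riesz]) and is
    proved there by minimising the quadratic energy of the functional
    ([riesz_representation]).

    The integral calculus used for [Q_i] needs [|nu|] to be a measure, also
    when [nu] takes an infinite value; this follows from the sigma-additivity
    of the upper variations of [nu] and [- nu] ([total_variation_measureP]). *)

Set Implicit Arguments.
Unset Strict Implicit.
Unset Printing Implicit Defensive.

Import Order.TTheory GRing.Theory Num.Theory.
Import numFieldNormedType.Exports.

Local Open Scope classical_set_scope.
Local Open Scope ring_scope.

(** * Real and imaginary parts *)

Section RealImaginaryParts.
Context (R : realType).
Implicit Types a z w : R[i].

Lemma conjE z : z^* = Complex (complex.Re z) (- complex.Im z).
Proof. by case: z. Qed.

Lemma ReD z w : complex.Re (z + w) = complex.Re z + complex.Re w.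
Proof. by case: z w => [? ?] [? ?]. Qed.

Lemma ReB z w : complex.Re (z - w) = complex.Re z - complex.Re w.
Proof. by case: z w => [? ?] [? ?]. Qed.

Lemma ReZ (b : R) z : complex.Re (b%:C%C * z) = b * complex.Re z.
Proof. by case: z => ? ? /=; rewrite mul0r subr0. Qed.

Lemma Re_linear_comb a z w :
  complex.Re (a * z + w) = complex.Re a * complex.Re z +
    - complex.Im a * complex.Im z + complex.Re w.
Proof. by case: a z w => [? ?] [? ?] [? ?]; rewrite /= mulNr. Qed.

Lemma Im_linear_comb a z w :
  complex.Im (a * z + w) = complex.Re a * complex.Im z +
    complex.Im a * complex.Re z + complex.Im w.
Proof. by case: a z w => [? ?] [? ?] [? ?]. Qed.

Lemma Re_conjM z w : complex.Re (z^* * w) =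
  complex.Re z * complex.Re w + complex.Im z * complex.Im w.
Proof. by rewrite conjE; case: z w => [? ?] [? ?]; rewrite /= mulNr opprK. Qed.

Lemma Im_conjM z w : complex.Im (z^* * w) =
  complex.Re z * complex.Im w - complex.Im z * complex.Re w.
Proof. by rewrite conjE; case: z w => [? ?] [? ?]; rewrite /= mulNr. Qed.

Lemma sqr_norm_complexE z :
  complex.Re `|z| ^+ 2 = complex.Re z ^+ 2 + complex.Im z ^+ 2.
Proof. by rewrite normc_def/= sqr_sqrtr// addr_ge0// sqr_ge0. Qed.

End RealImaginaryParts.

(** * The total variation of a signed measure is a measure *)

Section TotalVariation.
Context (d : measure_display) (T : measurableType d) (R : realType).
Implicit Types (nu : set T -> \bar R) (A : set T).

Definition upper_variation nu A : \bar R :=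
  ereal_sup [set nu B | B in [set B | measurable B /\ B `<=` A]].

Lemma upper_variation_ub nu A B :
  measurable B -> B `<=` A -> (nu B <= upper_variation nu A)%E.
Proof. by move=> mB BA; apply: ereal_sup_ubound; exists B. Qed.

(** Opposite commutes with the partial sums: these are values of [nu], which
    omits one of the two infinite values, so that no sum [+oo - oo] occurs. *)
Lemma signed_measureN nu :
  signed_measure nu -> signed_measure (fun A => - nu A)%E.
Proof.
case=> nu0 nu_inf nu_add; split; first by rewrite nu0 oppe0.
  by case: nu_inf => nuP; [right|left] => A mA; rewrite eqe_oppLR /= nuP.
move=> F mF tF mUF; apply: cvg_trans (cvgeN (nu_add F mF tF mUF)).
apply: near_eq_cvg; apply: nearW => n; elim: n => [|n IHn].
  by rewrite !big_geq // oppe0.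
rewrite !big_nat_recr //= -IHn oppeD //.
have [D mD ->] : exists2 D, measurable D &
    (\sum_(0 <= i < n) nu (F i))%E = nu D.
  exists (\big[setU/set0]_(i < n) F i); first exact: bigsetU_measurable.
  rewrite (semi_sigma_additive_is_additive nu0 nu_add) ?big_mkord//.
  exact: bigsetU_measurable.
rewrite /adde_def; case: nu_inf => nuP.
  by rewrite (negbTE (nuP _ mD)) (negbTE (nuP _ (mF n))) !andbF.
by rewrite (negbTE (nuP _ mD)) (negbTE (nuP _ (mF n))) andbF.
Qed.

Section Upper.
Context (nu : set T -> \bar R) (nuP : signed_measure nu).

Let nu0 : nu set0 = 0%E. Proof. by case: nuP. Qed.

Lemma upper_variation0 : upper_variation nu set0 = 0%E.
Proof.
apply/eqP; rewrite eq_le -{2}nu0 upper_variation_ub// andbT.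
by apply: ge_ereal_sup => _ [B [_ + <-]]; rewrite subset0 => ->; rewrite nu0.
Qed.

Lemma upper_variation_ge0 A : (0 <= upper_variation nu A)%E.
Proof. by rewrite -nu0 upper_variation_ub. Qed.

(** Disjoint measurable subsets of [A] and [A'] can be merged by additivity;
    nearly optimal ones exist as soon as the right-hand side is finite. *)
Lemma upper_variation_superadditive A A' : A `&` A' = set0 ->
  (upper_variation nu A + upper_variation nu A' <=
   upper_variation nu (A `|` A'))%E.
Proof.
move=> AA'.
have nuU B B' : measurable B -> B `<=` A -> measurable B' -> B' `<=` A' ->
    (nu B + nu B' <= upper_variation nu (A `|` A'))%E.
  move=> mB BA mB' BA'.
  have [_ _ /(semi_sigma_additive_is_additive nu0)/(additive2P nu0) nuD] := nuP.
  rewrite -nuD//; last by apply: subsetI_eq0 AA'.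
  by apply: upper_variation_ub; [exact: measurableU|exact: setUSS].
case: (ltgtP (upper_variation nu (A `|` A')) +oo%E); last 2 first.
- by rewrite ltNge leey.
- by move=> ->; rewrite leey.
move=> Uoo.
have Ufin : upper_variation nu (A `|` A') \is a fin_num.
  by rewrite ge0_fin_numE// upper_variation_ge0.
have finL C : C `<=` A `|` A' -> upper_variation nu C \is a fin_num.
  move=> CA; rewrite ge0_fin_numE ?upper_variation_ge0//.
  apply: le_lt_trans Uoo; apply: ge_ereal_sup => _ [B [mB BC] <-].
  by apply: upper_variation_ub => //; exact: subset_trans CA.
have fA : upper_variation nu A \is a fin_num by apply: finL; left.
have fA' : upper_variation nu A' \is a fin_num by apply: finL; right.
apply/lee_addgt0Pr => e e0.
have e20 : 0 < e / 2 by rewrite divr_gt0.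
have [_ [B [mB BA] <-]] := ub_ereal_sup_adherent e20 fA.
have [_ [B' [mB' BA'] <-]] := ub_ereal_sup_adherent e20 fA'.
rewrite -/(upper_variation nu A) -/(upper_variation nu A').
rewrite !lteBlDr// => ltB' ltB.
apply: le_trans (leeD (ltW ltB) (ltW ltB')) _.
rewrite addeACA -EFinD -splitr leeD2r// nuU//.
Qed.

(** A subset of the union is cut along the pieces, which bounds the variation
    of the union by the sum of the series; the partial sums are bounded through
    finite superadditivity. *)
Lemma upper_variation_sigma_additive :
  semi_sigma_additive (upper_variation nu).
Proof.
move=> F mF tF mUF.
have cvgS : cvgn (fun n => \sum_(0 <= i < n) upper_variation nu (F i))%E.
  by apply: is_cvg_nneseries => n _ _; exact: upper_variation_ge0.
suff -> : upper_variation nu (\bigcup_n F n) =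
    limn (fun n => \sum_(0 <= i < n) upper_variation nu (F i))%E by [].
apply/eqP; rewrite eq_le; apply/andP; split.
  apply: ge_ereal_sup => _ [B [mB BF] <-].
  have -> : B = \bigcup_n (B `&` F n).
    by rewrite -setI_bigcupr; apply/esym/setIidPl.
  have [_ _ nuS] := nuP.
  have mBF n : measurable (B `&` F n) by exact: measurableI.
  have cvgB := nuS _ mBF (trivIset_setIl tF) (bigcupT_measurable _ mBF).
  rewrite -(cvg_lim _ cvgB)//; apply: lee_lim => //.
    by apply/cvg_ex; exists (nu (\bigcup_n (B `&` F n))).
  apply: nearW => n; apply: lee_sum => i _.
  by apply: upper_variation_ub => //; exact: subIsetr.
apply: lime_le => //; apply: nearW => n.
apply: (@le_trans _ _ (upper_variation nu (\big[setU/set0]_(i < n) F i))).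
  elim: n => [|n IHn]; first by rewrite big_geq// upper_variation_ge0.
  rewrite big_nat_recr//= big_ord_recr/=.
  apply: le_trans (upper_variation_superadditive _); first exact: leeD.
  by apply: (@trivIset_bigsetUI _ predT) => //; exact: sub_trivIset tF.
apply: ge_ereal_sup => _ [B [mB BF] <-]; apply: upper_variation_ub => //.
by apply: subset_trans BF _; rewrite -bigcup_mkord => x [i _ Fx]; exists i.
Qed.

End Upper.

Lemma total_variation_measureP nu : signed_measure nu ->
  exists mu : {measure set T -> \bar R},
    (mu : set T -> \bar R) = total_variation_measure nu.
Proof.
move=> nuP; have nuNP := signed_measureN nuP.
pose mup := isMeasure.Build _ _ _ (upper_variation nu) (upper_variation0 nuP)
  (upper_variation_ge0 nuP) (upper_variation_sigma_additive nuP).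
pose mum := isMeasure.Build _ _ _ (upper_variation (fun A => - nu A)%E)
  (upper_variation0 nuNP) (upper_variation_ge0 nuNP)
  (upper_variation_sigma_additive nuNP).
pose mp : {measure set T -> \bar R} := HB.pack (upper_variation nu) mup.
pose mm : {measure set T -> \bar R} :=
  HB.pack (upper_variation (fun A => - nu A)%E) mum.
exists (measure_add mp mm); apply/funext => A.
by rewrite [LHS]measure_addE.
Qed.

End TotalVariation.

(** * Complex-valued integrals *)

Section ComplexIntegral.
Context (d : measure_display) (T : measurableType d) (R : realType).
Context (mu : {measure set T -> \bar R}).
Implicit Types (f g : T -> R[i]) (a z w : R[i]).

Lemma integrable_comb3 (b c : R) (u v w : T -> R) :
  mu.-integrable setT (EFin \o u) -> mu.-integrable setT (EFin \o v) ->
  mu.-integrable setT (EFin \o w) ->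
  mu.-integrable setT (EFin \o (fun x => b * u x + c * v x + w x)).
Proof.
move=> iu iv iw; have mT := @measurableT _ T.
exact: (integrableD mT
  (integrableD mT (integrableZl mT b iu) (integrableZl mT c iv)) iw).
Qed.

Lemma Rintegral_comb3 (b c : R) (u v w : T -> R) :
  mu.-integrable setT (EFin \o u) -> mu.-integrable setT (EFin \o v) ->
  mu.-integrable setT (EFin \o w) ->
  Rintegral mu setT (fun x => b * u x + c * v x + w x) =
  b * Rintegral mu setT u + c * Rintegral mu setT v + Rintegral mu setT w.
Proof.
move=> iu iv iw; have mT := @measurableT _ T.
have ibu : mu.-integrable setT (EFin \o (fun x => b * u x)).
  exact: (integrableZl mT b iu).
have icv : mu.-integrable setT (EFin \o (fun x => c * v x)).
  exact: (integrableZl mT c iv).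
by rewrite !RintegralD ?RintegralZl//; exact: (integrableD mT ibu icv).
Qed.

Lemma cintegrable_linear a f g : cintegrable mu f -> cintegrable mu g ->
  cintegrable mu (fun x => a * f x + g x).
Proof.
move=> [fr fi] [gr gi]; split.
- apply: eq_integrable
    (integrable_comb3 (complex.Re a) (- complex.Im a) fr fi gr) => //.
  by move=> x _ /=; rewrite Re_linear_comb.
- apply: eq_integrable
    (integrable_comb3 (complex.Re a) (complex.Im a) fi fr gi) => //.
  by move=> x _ /=; rewrite Im_linear_comb.
Qed.

Lemma cintegral_linear a f g : cintegrable mu f -> cintegrable mu g ->
  cintegral mu (fun x => a * f x + g x) = a * cintegral mu f + cintegral mu g.
Proof.
move=> [fr fi] [gr gi].
apply/eqP; rewrite eq_complex Re_linear_comb Im_linear_comb /cintegral/=.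
have /= := Rintegral_comb3 (complex.Re a) (- complex.Im a) fr fi gr.
have /= := Rintegral_comb3 (complex.Re a) (complex.Im a) fi fr gi.
rewrite /Rintegral => <- <-; apply/andP; split; apply/eqP; congr fine;
  by apply: eq_integral => x _; rewrite ?Re_linear_comb ?Im_linear_comb.
Qed.

Lemma cintegral_conj f : cintegrable mu f ->
  cintegral mu (fun x => (f x)^*) = (cintegral mu f)^*.
Proof.
move=> [fr fi]; rewrite /cintegral conjE/=; congr Complex.
  by congr fine; apply: eq_integral => x _; rewrite conjE.
rewrite -fineN; congr fine; rewrite -integralN; last first.
  exact: integrable_add_def.
by apply: eq_integral => x _; rewrite conjE.
Qed.

Definition square_integrable f : Prop :=
  cmeasurable f /\
  mu.-integrable setT (fun x => (complex.Re `|f x| ^+ 2)%:E).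

(** Both parts of the product are at most [|f|^2 + |g|^2] in absolute value. *)
Lemma cintegrable_conjM f g : square_integrable f -> square_integrable g ->
  cintegrable mu (fun x => (f x)^* * g x).
Proof.
move=> [[fr fi] fsq] [[gr gi] gsq].
have fgsq := integrableD measurableT fsq gsq.
have bound (p q r s : R) :
    `|p * r + q * s| <= `|(p ^+ 2 + q ^+ 2) + (r ^+ 2 + s ^+ 2)|.
  have h0 : 0 <= (p ^+ 2 + q ^+ 2) + (r ^+ 2 + s ^+ 2).
    by rewrite !addr_ge0// sqr_ge0.
  rewrite (ger0_norm h0) ler_norml.
  have := sqr_ge0 (p + r); have := sqr_ge0 (q + s).
  have := sqr_ge0 (p - r); have := sqr_ge0 (q - s).
  by move=> *; apply/andP; split; nra.
split; apply: le_integrable fgsq => //.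
- apply/measurable_EFinP.
  rewrite (_ : (fun x => _) = fun x => complex.Re (f x) * complex.Re (g x) +
      complex.Im (f x) * complex.Im (g x)).
    by apply: measurable_funD; exact: measurable_funM.
  by apply/funext => x; rewrite Re_conjM.
- by move=> x _; rewrite lee_fin !sqr_norm_complexE Re_conjM bound.
- apply/measurable_EFinP.
  rewrite (_ : (fun x => _) = fun x => complex.Re (f x) * complex.Im (g x) -
      complex.Im (f x) * complex.Re (g x)).
    by apply: measurable_funB; exact: measurable_funM.
  by apply/funext => x; rewrite Im_conjM.
- move=> x _; rewrite lee_fin !sqr_norm_complexE Im_conjM.
  have := bound (complex.Re (f x)) (- complex.Im (f x))
                (complex.Im (g x)) (complex.Re (g x)).
  by rewrite sqrrN mulNr [complex.Im (g x) ^+ 2 + _]addrC.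
Qed.

End ComplexIntegral.

(** * Hermitian forms and the Riesz representation theorem *)

Lemma discriminant_le (R : realType) (a b c : R) : 0 <= a ->
  (forall t, 0 <= c + 2 * t * b + t ^+ 2 * a) -> b ^+ 2 <= a * c.
Proof.
move=> a0 qP; have [a_eq0|a_neq0] := eqVneq a 0.
  suff -> : b = 0 by rewrite a_eq0 mul0r expr0n.
  apply/eqP; apply: contraT => b0; have := qP (- (c + 1) / (2 * b)).
  rewrite a_eq0 mulr0 addr0 (_ : _ + _ = -1); first lra.
  by field; rewrite b0.
have a_gt0 : 0 < a by rewrite lt_def a_neq0.
have := qP (- b / a); rewrite (_ : _ + _ = c - b ^+ 2 / a); last by field.
by rewrite subr_ge0 ler_pdivrMr// mulrC.
Qed.

Section HermitianForms.
Context (R : realType) (K : lmodType R[i]) (g : K -> K -> R[i]).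
Hypothesis g_herm : hermitian_form g.
Implicit Types (u v w : K) (a : R[i]) (t : R).

Lemma form_linearr h a u v : g h (a *: u + v) = a * g h u + g h v.
Proof. by case: g_herm. Qed.

Lemma form_conj u v : g v u = (g u v)^*.
Proof. by case: g_herm. Qed.

Lemma form0r u : g u 0 = 0.
Proof.
by have := form_linearr u (-1) 0 0; rewrite scaler0 addr0 mulN1r addNr.
Qed.

Lemma formDr h u v : g h (u + v) = g h u + g h v.
Proof. by rewrite -[in LHS](scale1r u) form_linearr mul1r. Qed.

Lemma formZr h a u : g h (a *: u) = a * g h u.
Proof. by rewrite -[in LHS](addr0 (a *: u)) form_linearr form0r addr0. Qed.

Lemma formNr h u : g h (- u) = - g h u.
Proof. by rewrite -scaleN1r formZr mulN1r. Qed.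

Lemma formDl u v w : g (u + v) w = g u w + g v w.
Proof. by rewrite form_conj formDr rmorphD/= -!form_conj. Qed.

Lemma formZl a u w : g (a *: u) w = a^* * g u w.
Proof. by rewrite form_conj formZr rmorphM/= -form_conj. Qed.

Lemma formNl u w : g (- u) w = - g u w.
Proof. by rewrite form_conj formNr rmorphN/= -form_conj. Qed.

Lemma formBl u v w : g (u - v) w = g u w - g v w.
Proof. by rewrite formDl formNl. Qed.

Lemma Re_form_sym u v : complex.Re (g v u) = complex.Re (g u v).
Proof. by rewrite form_conj conjE. Qed.

Lemma Re_form_line u v t :
  complex.Re (g (u + t%:C%C *: v) (u + t%:C%C *: v)) =
  complex.Re (g u u) + 2 * t * complex.Re (g u v) + t ^+ 2 * complex.Re (g v v).
Proof.
rewrite formDr formZr !ReD ReZ !(Re_form_sym _ (_ + _)).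
rewrite !formDr !formZr !ReD !ReZ (Re_form_sym u v).
ring.
Qed.

Section Subspace.
Context (V : set K) (V_sub : linear_subspace V).
Hypothesis g_ge0 : forall v, V v -> 0 <= complex.Re (g v v).

Lemma subspaceD u v : V u -> V v -> V (u + v).
Proof. by move=> Vu Vv; rewrite -(scale1r u); apply: V_sub.2. Qed.

Lemma subspaceZ a u : V u -> V (a *: u).
Proof.
by move=> Vu; rewrite -(addr0 (_ *: _)); apply: V_sub.2 => //; exact: V_sub.1.
Qed.

Lemma subspaceB u v : V u -> V v -> V (u - v).
Proof.
by move=> Vu Vv; rewrite -scaleN1r; apply: subspaceD => //; exact: subspaceZ.
Qed.

Lemma form_Cauchy_Schwarz u v : V u -> V v ->
  complex.Re (g u v) ^+ 2 <= complex.Re (g v v) * complex.Re (g u u).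
Proof.
move=> Vu Vv; apply: discriminant_le => [|t]; first exact: g_ge0.
by rewrite -Re_form_line; apply/g_ge0/subspaceD => //; exact: subspaceZ.
Qed.

End Subspace.

Section Riesz.
Context (V : set K) (V_hilbert : hilbert_subspace g V).
Context (f : K -> R[i]) (C : R).
Hypothesis f_linear : forall a u v, f (a *: u + v) = a * f u + f v.
Hypothesis C_ge0 : 0 <= C.
Hypothesis f_bounded :
  forall v, V v -> complex.Re (f v) ^+ 2 <= C * complex.Re (g v v).

Let V_sub : linear_subspace V. Proof. by case: V_hilbert. Qed.

Lemma hilbert_form_ge0 v : V v -> 0 <= complex.Re (g v v).
Proof.
move=> Vv; have [->|v0] := eqVneq v 0; first by rewrite form0r.
by have [_ /(_ v Vv v0)] := V_hilbert; rewrite ltcE => /andP[_ /ltW].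
Qed.

(** Up to a constant, the squared distance of [u] to the vector sought. *)
Let energy u : R := complex.Re (g u u) - 2 * complex.Re (f u).

Let energy_line u v t : energy (u + t%:C%C *: v) =
  energy u + 2 * t * (complex.Re (g u v) - complex.Re (f v)) +
  t ^+ 2 * complex.Re (g v v).
Proof.
rewrite /energy Re_form_line addrC (addrC u) f_linear Re_linear_comb/=; ring.
Qed.

Let energy_lb u : V u -> - C <= energy u.
Proof.
move=> Vu; have := f_bounded Vu; have := hilbert_form_ge0 Vu.
rewrite /energy; move: (complex.Re _) (complex.Re _) => p q q0 pq.
have [|lt0] := leP 0 (q + C - 2 * p); first lra.
have lt_pos : 0 < (2 * p - (q + C)) * (2 * p + (q + C)).
  by apply: mulr_gt0; have := C_ge0; lra.
have := sqr_ge0 (q - C); nra.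
Qed.

Let m := inf [set energy v | v in V].

Let energy_has_inf : has_inf [set energy v | v in V].
Proof.
split; first by exists (energy 0), 0 => //; exact: V_sub.1.
by exists (- C) => _ [v Vv <-]; exact: energy_lb.
Qed.

Let energy_ge v : V v -> m <= energy v.
Proof.
by move=> Vv; apply: ge_inf; [exact: energy_has_inf.2|exists v].
Qed.

(** The parallelogram identity, as the midpoint has energy at least [m]:
    minimising sequences are Cauchy. *)
Let energy_gap u v : V u -> V v ->
  complex.Re (g (u - v) (u - v)) <= 2 * (energy u - m) + 2 * (energy v - m).
Proof.
move=> Vu Vv.
have := energy_line v (u - v) 1; have := energy_line v (u - v) 2^-1.
have := energy_ge (subspaceD V_sub Vv
  (subspaceZ V_sub (2^-1)%:C%C (subspaceB V_sub Vu Vv))).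
have -> : v + 1%:C%C *: (u - v) = u by rewrite rmorph1 scale1r addrC subrK.
lra.
Qed.

Let minimizing_seq : exists u : nat -> K,
  forall k, V (u k) /\ energy (u k) < m + harmonic k.
Proof.
have minimizer k : exists u, V u /\ energy u < m + harmonic k.
  have [_ [u Vu <-] ltu] := inf_adherent (harmonic_gt0 k) energy_has_inf.
  by exists u.
by have [u uP] := choice minimizer; exists u.
Qed.

(** The limit [l] of a minimising sequence [u] represents [f].  Since [u k]
    almost minimises the energy along the line of direction [v], a discriminant
    bounds the defect of [g (u k) v] from [f v] in real part; imaginary parts
    are the real parts taken at ['i *: v]. *)
Lemma riesz_representation : exists2 w, V w & forall v, V v -> f v = g w v.
Proof.
have [u /all_and2[Vu ltu]] := minimizing_seq.
have [_ _ V_complete] := V_hilbert.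
have [|l Vl ul] := V_complete u Vu.
  move=> e e0.
  have e20 : 0 < e ^+ 2 / 4 by rewrite divr_gt0 ?exprn_gt0.
  have [N _ NP] := near_infty_natSinv_lt (PosNum e20).
  have {}NP k : (N <= k)%N -> harmonic k < e ^+ 2 / 4 := NP k.
  exists N => i j /NP lti /NP ltj; rewrite /form_norm.
  have eE : e = Num.sqrt (e ^+ 2) by rewrite sqrtr_sqr gtr0_norm.
  rewrite [ltRHS]eE ltr_sqrt ?exprn_gt0//.
  have := energy_gap (Vu i) (Vu j); have := ltu i; have := ltu j; lra.
suff ReE v : V v -> complex.Re (f v) = complex.Re (g l v).
  exists l => // v Vv.
  have f0 : f 0 = 0.
    by have := f_linear (-1) 0 0; rewrite scaler0 addr0 mulN1r addNr.
  have := ReE _ (subspaceZ V_sub 'i%C Vv); have := ReE _ Vv.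
  rewrite formZr -(addr0 (_ *: _)) f_linear f0 addr0 !(mulrC 'i%C) !ReiNIm.
  by move=> ReEq /oppr_inj ImEq; apply/eqP; rewrite eq_complex ReEq ImEq !eqxx.
move=> Vv.
(* Both [g l v] and [f v] are close to [g (u k) v] in real part. *)
have lim0 : (fun k => 2 * complex.Re (g v v) *
    (harmonic k + form_norm g (u k - l) ^+ 2)) @ \oo --> (0 : R).
  have -> : (0 : R) = 2 * complex.Re (g v v) * (0 + 0 ^+ 2).
    by rewrite expr0n addr0 mulr0.
  apply: cvgMr; apply: cvgD; first exact: cvg_harmonic.
  by apply: cvgM.
apply/eqP; rewrite eq_sym -subr_eq0 -sqrf_eq0 eq_le sqr_ge0 andbT.
apply: ler_cvg_to (cvg_cst _) lim0 _; apply: nearW => k.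
have energy_var : (complex.Re (g (u k) v) - complex.Re (f v)) ^+ 2 <=
    complex.Re (g v v) * (energy (u k) - m).
  apply: discriminant_le => [|t]; first exact: hilbert_form_ge0.
  have := energy_ge (subspaceD V_sub (Vu k) (subspaceZ V_sub t%:C%C Vv)).
  rewrite energy_line; lra.
have dist_var : complex.Re (g (u k - l) v) ^+ 2 <=
    complex.Re (g v v) * form_norm g (u k - l) ^+ 2.
  have Vul := subspaceB V_sub (Vu k) Vl.
  rewrite /form_norm sqr_sqrtr; last exact: hilbert_form_ge0.
  exact: (form_Cauchy_Schwarz V_sub hilbert_form_ge0).
have := hilbert_form_ge0 Vv; have := ltu k; move: energy_var dist_var.
rewrite formBl ReB.
move: (complex.Re (g (u k) v)) (complex.Re (g l v)) (complex.Re (f v))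
  (complex.Re (g v v)) (energy _) (form_norm _ _) (harmonic k)
  => p q r n e t h b1 b2 eh n0.
have : n * (e - m) <= n * h by apply: ler_wpM2l => //; lra.
have := sqr_ge0 ((p - r) + (p - q)); nra.
Qed.

End Riesz.
End HermitianForms.

(** * Operators on a Krein space *)

Section KreinSpaces.
Context (R : realType) (K : lmodType R[i]) (ip : K -> K -> R[i]) (J : K -> K).
Hypothesis K_krein : krein_space ip J.
Implicit Types (h k u v w : K) (A B : {linear K -> K}).

Lemma krein_form : hermitian_form ip. Proof. by case: K_krein. Qed.

Lemma hermitian_formN : hermitian_form (fun u v => - ip u v).
Proof.
split=> [h a k l|h k]; first by rewrite (form_linearr krein_form) opprD mulrN.
by rewrite (form_conj krein_form h k) rmorphN.
Qed.

Definition J_sqnorm k : R := complex.Re (ip k (J k)).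

Lemma J_sqnorm_decomposition Kp Km (KpmP : fundamental_decomposition ip Kp Km)
    (JE : forall kp km, Kp kp -> Km km -> J (kp + km) = kp - km) kp km :
  Kp kp -> Km km ->
  J_sqnorm (kp + km) = complex.Re (ip kp kp) + complex.Re (- ip km km).
Proof.
move=> pkp mkm; have [_ _ orth _ _] := KpmP.
have gP := krein_form.
rewrite /J_sqnorm JE// (formDl gP) !(formDr gP) !(formNr gP).
rewrite (form_conj gP kp km) (orth _ _ pkp mkm) conjE/=.
by case: (ip kp kp) (ip km km) => [? ?] [? ?] /=; ring.
Qed.

Lemma J_sqnorm_ge0 k : 0 <= J_sqnorm k.
Proof.
have [_ [Kp [Km [KpmP JE]]]] := K_krein.
have [Hp Hm _ _ /(_ k)[kp [km [pkp mkm ->]]]] := KpmP.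
rewrite (J_sqnorm_decomposition KpmP JE pkp mkm) addr_ge0//.
  exact: (hilbert_form_ge0 krein_form Hp).
exact: (hilbert_form_ge0 hermitian_formN Hm).
Qed.

Lemma J_sqnormJ k : J_sqnorm (J k) = J_sqnorm k.
Proof.
have [_ [Kp [Km [KpmP JE]]]] := K_krein.
have [Hp Hm _ _ /(_ k)[kp [km [pkp mkm ->]]]] := KpmP.
have mNkm : Km (- km).
  have [Km_sub _ _] := Hm.
  by rewrite -scaleN1r; exact: (subspaceZ Km_sub).
rewrite JE// !(J_sqnorm_decomposition KpmP JE)//.
by rewrite (formNl krein_form) (formNr krein_form) opprK.
Qed.

Lemma J_normE k : J_norm ip J k = Num.sqrt (J_sqnorm k).
Proof. by []. Qed.

(** Pairing with the two components of [w] in turn, the definiteness of [ip] on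
    each summand kills them. *)
Lemma krein_nondegenerate w : (forall h, ip h w = 0) -> w = 0.
Proof.
move=> w0; have [_ [Kp [Km [KpmP JE]]]] := K_krein.
have [[_ Kp_pos _] [_ Km_pos _] orth _ /(_ w)[kp [km [pkp mkm wE]]]] := KpmP.
have gP := krein_form.
have := w0 kp; rewrite wE (formDr gP) (orth _ _ pkp mkm) addr0 => kp0.
have := w0 km; rewrite wE (formDr gP) (form_conj gP kp km) (orth _ _ pkp mkm).
rewrite rmorph0 add0r => km0.
have -> : kp = 0.
  by apply: contra_eq kp0 => /(Kp_pos _ pkp); rewrite lt_def => /andP[].
have -> : km = 0.
  apply: contra_eq km0 => /(Km_pos _ mkm).
  by rewrite lt_def oppr_eq0 => /andP[].
by rewrite addr0.
Qed.

Lemma krein_form_inj u v : (forall h, ip h u = ip h v) -> u = v.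
Proof.
move=> uv; apply/eqP; rewrite -subr_eq0; apply/eqP/krein_nondegenerate => h.
by rewrite (formDr krein_form) (formNr krein_form) uv subrr.
Qed.

(** [f] is represented by [wp] on the positive summand and by [wm] on the
    negative one, where the Hilbert inner product is [- ip]; hence
    [w = wp - wm]. *)
Lemma krein_riesz (f : K -> R[i]) (C : R) :
  (forall a u v, f (a *: u + v) = a * f u + f v) -> 0 <= C ->
  (forall v, complex.Re (f v) ^+ 2 <= C * J_sqnorm v) ->
  exists w, forall v, f v = ip w v.
Proof.
move=> f_lin C0 fC; have [_ [Kp [Km [KpmP JE]]]] := K_krein.
have [Hp Hm orth _ dec] := KpmP; have gP := krein_form.
have [Kp_sub _ _] := Hp; have [Km_sub _ _] := Hm.
have [|wp pwp fp] := riesz_representation gP Hp f_lin C0.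
  move=> v pv; apply: le_trans (fC v) _; rewrite -{1}(addr0 v).
  rewrite (J_sqnorm_decomposition KpmP JE pv Km_sub.1).
  by rewrite (form0r gP) oppr0 addr0.
have [|wm mwm fm] := riesz_representation hermitian_formN Hm f_lin C0.
  move=> v mv; apply: le_trans (fC v) _; rewrite -{1}(add0r v).
  rewrite (J_sqnorm_decomposition KpmP JE Kp_sub.1 mv).
  by rewrite (form0r gP) add0r.
exists (wp - wm) => v; have [vp [vm [pvp mvm ->]]] := dec v.
rewrite -[X in f (X + _)]scale1r f_lin mul1r fp// fm// (formBl gP) !(formDr gP).
rewrite (orth _ _ pwp mvm) (form_conj gP vp wm) (orth _ _ pvp mwm).
by rewrite rmorph0 addr0 add0r.
Qed.

(** Every value [A k] comes from the Riesz theorem, nondegeneracy makes [A]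
    linear, and Cauchy-Schwarz for [q] at [k] and [J (A k)] bounds [A k] by
    [b] times the [J]-norm of [k]. *)
Lemma bounded_form_operator (q : K -> K -> R[i]) (b : R) :
  hermitian_form q -> 0 <= b ->
  (forall k, 0 <= complex.Re (q k k) <= b * J_sqnorm k) ->
  exists A, bounded_operator ip J A /\ forall h k, ip h (A k) = q h k.
Proof.
move=> q_herm b0 qb; have gP := krein_form.
have q_CS h k : complex.Re (q h k) ^+ 2 <=
    complex.Re (q k k) * complex.Re (q h h).
  have T_sub : linear_subspace [set: K] by [].
  apply: (form_Cauchy_Schwarz q_herm T_sub) => // v _.
  by have /andP[] := qb v.
have repr k : exists w, forall h, q k h = ip w h.
  have /andP[qk0 _] := qb k.
  apply: (@krein_riesz _ (b * complex.Re (q k k))) => [a u v||v].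
  - exact: (form_linearr q_herm).
  - exact: mulr_ge0.
  - apply: le_trans (q_CS _ _) _; rewrite mulrAC ler_wpM2r//.
    by have /andP[] := qb v.
have [A0 A0E] := choice repr.
have A0q h k : ip h (A0 k) = q h k.
  by rewrite (form_conj gP (A0 k)) -A0E -(form_conj q_herm).
have A0_lin : linear A0.
  move=> a u v; apply: krein_form_inj => h.
  by rewrite (form_linearr gP) !A0q (form_linearr q_herm).
pose A : {linear K -> K} :=
  HB.pack A0 (GRing.isLinear.Build R[i] K K *:%R A0 A0_lin).
exists A; split=> //; exists b => k; rewrite !J_normE.
have key : J_sqnorm (A k) ^+ 2 <= b ^+ 2 * J_sqnorm k * J_sqnorm (A k).
  rewrite {1}/J_sqnorm -A0E; apply: le_trans (q_CS _ _) _.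
  have /andP[q0 qle] := qb (J (A k)); have /andP[q0' qle'] := qb k.
  rewrite J_sqnormJ in qle.
  apply: le_trans (ler_pM q0 q0' qle qle') _.
  by rewrite le_eqVlt; apply/orP; left; apply/eqP; ring.
rewrite -{1}(ger0_norm b0) -sqrtr_sqr -sqrtrM ?sqr_ge0// ler_sqrt; last first.
  by rewrite mulr_ge0 ?sqr_ge0// J_sqnorm_ge0.
have := J_sqnorm_ge0 (A k); rewrite le_eqVlt => /orP[/eqP<-|Ak0].
  by rewrite mulr_ge0 ?sqr_ge0// J_sqnorm_ge0.
by rewrite -(ler_pM2r Ak0) -expr2.
Qed.

Lemma bounded_operator_comp A B : bounded_operator ip J A ->
  bounded_operator ip J B -> bounded_operator ip J (A \o B).
Proof.
move=> [a aP] [b bP]; exists (`|a| * b) => k; rewrite -mulrA.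
apply: le_trans (aP _) _.
apply: (@le_trans _ _ (`|a| * J_norm ip J (B k))).
  by rewrite ler_wpM2r ?sqrtr_ge0// ler_norm.
by rewrite ler_wpM2l.
Qed.

End KreinSpaces.

(** * Weak integrals and frames *)

Section FrameOperators.
Context (d : measure_display) (T : measurableType d) (R : realType).
Context (nu : set T -> \bar R) (K : lmodType R[i]).
Context (ip : K -> K -> R[i]) (J : K -> K).
Hypothesis K_krein : krein_space ip J.
Context (mu : {measure set T -> \bar R}).
Hypothesis mu_nu : (mu : set T -> \bar R) = total_variation_measure nu.
Implicit Types (h k : K) (eta : T -> K) (A B : {linear K -> K}).

Definition frame_form eta h k : R[i] :=
  cintegral mu (fun x => ip h (eta x) * ip (eta x) k).

Lemma cintegrable_frame_form eta h k :
  (forall l, square_integrable mu (fun x => ip (eta x) l)) ->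
  cintegrable mu (fun x => ip h (eta x) * ip (eta x) k).
Proof.
move=> eta2.
rewrite (_ : (fun x => _) = fun x => (ip (eta x) h)^* * ip (eta x) k).
  exact: cintegrable_conjM.
by apply/funext => x; rewrite -(form_conj (krein_form K_krein)).
Qed.

Lemma frame_form_hermitian eta :
  (forall l, square_integrable mu (fun x => ip (eta x) l)) ->
  hermitian_form (frame_form eta).
Proof.
move=> eta2; have gP := krein_form K_krein; split=> [h a k l|h k].
  rewrite /frame_form -cintegral_linear; try exact: cintegrable_frame_form.
  congr cintegral; apply/funext => x.
  by rewrite (form_linearr gP) mulrDr mulrCA.
rewrite /frame_form -cintegral_conj; last exact: cintegrable_frame_form.
congr cintegral; apply/funext => x.
by rewrite rmorphM/= -!(form_conj gP) mulrC.
Qed.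

Lemma Re_frame_form eta k : complex.Re (frame_form eta k k) =
  fine (\int[mu]_x (complex.Re `|ip (eta x) k| ^+ 2)%:E).
Proof.
congr fine; apply: eq_integral => x _.
by rewrite (form_conj (krein_form K_krein)) Re_conjM sqr_norm_complexE !expr2.
Qed.

Lemma Bessel_square_integrable eta (b : R) : weakly_measurable ip eta ->
  (forall k, (\int[mu]_x (complex.Re `|ip (eta x) k| ^+ 2)%:E <=
              (b * J_sqnorm ip J k)%:E)%E) ->
  forall k, square_integrable mu (fun x => ip (eta x) k).
Proof.
move=> meta eta_le k; split=> //; apply/integrableP; split.
  apply/measurable_EFinP; under eq_fun do rewrite sqr_norm_complexE.
  by case: (meta k) => ? ?; apply: measurable_funD; exact: measurable_funX.
under eq_integral do rewrite gee0_abs ?lee_fin ?sqr_ge0//.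
exact: le_lt_trans (eta_le k) (ltry _).
Qed.

(** The upper bound of a frame holds for each of its members, which can
    therefore be integrated one at a time. *)
Lemma Bessel_weak_integral eta (b : R) : 0 <= b -> weakly_measurable ip eta ->
  (forall k, (\int[mu]_x (complex.Re `|ip (eta x) k| ^+ 2)%:E <=
              (b * J_sqnorm ip J k)%:E)%E) ->
  exists A, weak_integral nu ip J (fun x => rank_one ip (eta x) (eta x)) A.
Proof.
move=> b0 meta eta_le; have gP := krein_form K_krein.
have eta2 := Bessel_square_integrable meta eta_le.
have [|A [A_bounded AE]] :=
    bounded_form_operator K_krein (frame_form_hermitian eta2) b0.
  move=> k; rewrite Re_frame_form fine_ge0/=; last first.
    by apply: integral_ge0 => x _; rewrite lee_fin sqr_ge0.
  rewrite -lee_fin fineK ?eta_le//; apply: integrable_fin_num => //.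
  by case: (eta2 k).
exists A; split=> // h k; rewrite -mu_nu AE.
rewrite (_ : (fun x => _) = fun x => ip h (eta x) * ip (eta x) k).
  by split=> //; exact: cintegrable_frame_form.
by apply/funext => x; rewrite /rank_one (formZr gP) mulrC.
Qed.

Lemma weak_integral_compr (F : T -> K -> K) A B :
  weak_integral nu ip J F A -> bounded_operator ip J B ->
  weak_integral nu ip J (fun x k => F x (B k)) (A \o B).
Proof.
move=> [A_bounded FA] B_bounded; split; first exact: bounded_operator_comp.
by move=> h k; exact: FA.
Qed.

Lemma weak_integral_compl (F : T -> K -> K) A B B' :
  weak_integral nu ip J F A -> bounded_operator ip J B ->
  (forall h k, ip h (B k) = ip (B' h) k) ->
  weak_integral nu ip J (fun x k => B (F x k)) (B \o A).
Proof.
move=> [A_bounded FA] B_bounded B_adj; split; first exact: bounded_operator_comp.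
move=> h k; rewrite /= B_adj; have := FA (B' h) k.
by rewrite (_ : (fun x => ip h (B (F x k))) = fun x => ip (B' h) (F x k))//;
  apply/funext => x.
Qed.

Lemma continuous_frame_Bessel (n : nat) (eta : 'I_n -> T -> K) :
  continuous_frame nu ip J eta -> exists2 b : R, 0 <= b & forall i k,
  (\int[mu]_x (complex.Re `|ip (eta i x) k| ^+ 2)%:E <=
   (b * J_sqnorm ip J k)%:E)%E.
Proof.
move=> [_ _ [a [b [a0 ab frame_le]]]].
exists b => [|i k]; first exact: le_trans (ltW a0) ab.
have /andP[_] := frame_le k; rewrite J_normE sqr_sqrtr ?J_sqnorm_ge0//.
apply: le_trans; rewrite -mu_nu (bigD1 i)//= leeDl// sume_ge0// => j _.
by apply: integral_ge0 => x _; rewrite lee_fin sqr_ge0.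
Qed.

End FrameOperators.

Theorem theorem3p6 (R : realType) (d : measure_display) (M : measurableType d)
    (nu : set M -> \bar R) (K : lmodType R[i]) (ip : K -> K -> R[i])
    (J : K -> K) (n : nat) (eta : 'I_n -> M -> K) (S Sinv : {linear K -> K})
    (nu_signed : signed_measure nu)
    (K_krein : krein_space ip J)
    (eta_frame : continuous_frame nu ip J eta)
    (S_frame_operator : frame_operator nu ip J eta S)
    (Sinv_bounded : bounded_operator ip J Sinv)
    (SK : cancel S Sinv) (SinvK : cancel Sinv S) :
  sum_weak_integrals nu ip J
    (fun i x => rank_one ip (eta i x) (Sinv (eta i x))) idfun /\
  sum_weak_integrals nu ip J
    (fun i x => rank_one ip (Sinv (eta i x)) (eta i x)) idfun.
Proof.
have gP := krein_form K_krein.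
have [mu mu_nu] := total_variation_measureP nu_signed.
have [b b0 eta_le] := continuous_frame_Bessel K_krein mu_nu eta_frame.
have [_ meta _] := eta_frame.
have eta2 i := Bessel_square_integrable (meta i) (eta_le i).
have [A AP] := choice (fun i =>
  Bessel_weak_integral K_krein mu_nu b0 (meta i) (eta_le i)).
have AE i h k : ip h (A i k) = frame_form ip mu (eta i) h k.
  have [_ /(_ h k)[_ <-]] := AP i; rewrite -mu_nu; congr cintegral.
  by apply/funext => x; rewrite /rank_one (formZr gP) mulrC.
have SE h k : ip h (S k) = \sum_(i < n) frame_form ip mu (eta i) h k.
  by have [_ ->] := S_frame_operator; rewrite -mu_nu.
have sum_form h (F : 'I_n -> K) :
    ip h (\sum_(i < n) F i) = \sum_(i < n) ip h (F i).
  by apply: (big_morph (ip h)); [exact: formDr|exact: form0r].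
have SA k : S k = \sum_(i < n) A i k.
  apply: (krein_form_inj K_krein) => h; rewrite SE sum_form.
  by apply: eq_bigr => i _; rewrite AE.
have S_sym h k : ip (S h) k = ip h (S k).
  rewrite (form_conj gP k) !SE rmorph_sum/=; apply: eq_bigr => i _.
  by rewrite -(form_conj (frame_form_hermitian K_krein (eta2 i))).
have Sinv_sym h k : ip h (Sinv k) = ip (Sinv h) k.
  by rewrite -[in RHS](SinvK k) -S_sym SinvK.
split.
- exists (fun i => A i \o Sinv); split=> [i|k]; last by rewrite /= -SA SinvK.
  have := weak_integral_compr (AP i) Sinv_bounded.
  congr (weak_integral _ _ _ _ _); apply/funext => x; apply/funext => k.
  by rewrite /rank_one Sinv_sym.
- exists (fun i => Sinv \o A i); split=> [i|k].
    have := weak_integral_compl (AP i) Sinv_bounded Sinv_sym.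
    congr (weak_integral _ _ _ _ _); apply/funext => x; apply/funext => k.
    by rewrite /rank_one linearZ.
  by rewrite /= -linear_sum -SA SK.
Qed.
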